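(* Let $A\in\mathbb{R}^{n\times n}$ be symmetric positive definite, let $S\in\mathbb{R}^{n\times n_{\rm s}}$ ($n_{\rm s}\leq n$) and $P\in\mathbb{R}^{n\times n_{\rm c}}$ ($n_{\rm c}<n$) be of full column rank with $\operatorname{rank}(S\ \, P)=n$ (and $S=I_n$ if $n_{\rm s}=n$), put $A_{\rm s}=S^{T}AS$, and let $M_{\rm s}\in\mathbb{R}^{n_{\rm s}\times n_{\rm s}}$ be a nonsingular matrix such that $M_{\rm s}+M_{\rm s}^{T}-A_{\rm s}$ is positive definite. Let $\widetilde{M}_{\rm s}=M_{\rm s}^{T}\big(M_{\rm s}+M_{\rm s}^{T}-A_{\rm s}\big)^{-1}M_{\rm s}$ and $\Pi_{A}=P(P^{T}AP)^{-1}P^{T}A$. Assume that $\widehat{P}\in\mathbb{R}^{n\times\hat{n}_{\rm c}}$ ($n_{\rm c}\leq\hat{n}_{\rm c}<n$) is of full column rank and $\operatorname{rank}(S\ \, \widehat{P})=n$, and define $\widehat{\Pi}_{A}=\widehat{P}(\widehat{P}^{T}A\widehat{P})^{-1}\widehat{P}^{T}A$. Let $$E_{\rm TL}=\big(I-SM_{\rm s}^{-T}S^{T}A\big)(I-\Pi_{A})\big(I-SM_{\rm s}^{-1}S^{T}A\big),\qquad \widehat{E}_{\rm TL}=\big(I-SM_{\rm s}^{-T}S^{T}A\big)(I-\widehat{\Pi}_{A})\big(I-SM_{\rm s}^{-1}S^{T}A\big)$$ be the iteration matrices of the two-level method with prolongation matrices $P$ and $\widehat{P}$, respectively. If $\mathcal{R}(P)\subseteq\mathcal{R}(\widehat{P})$,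 then $$\|\widehat{E}_{\rm TL}\|_{A}\leq\|E_{\rm TL}\|_{A},$$ where $$\|\widehat{E}_{\rm TL}\|_{A}=1-\lambda_{n_{\rm s}+\hat{n}_{\rm c}-n+1}\big(\widetilde{M}_{\rm s}^{-1}S^{T}A(I-\widehat{\Pi}_{A})S\big),\qquad \|E_{\rm TL}\|_{A}=1-\lambda_{n_{\rm s}+n_{\rm c}-n+1}\big(\widetilde{M}_{\rm s}^{-1}S^{T}A(I-\Pi_{A})S\big).$$
   Context: $(S\ \, P)$ denotes the matrix formed by the columns of $S$ followed by those of $P$; $\mathcal{R}(\cdot)$ denotes the column space. For a matrix with real spectrum (as is the case here), $\lambda_{i}(\cdot)$ denotes the $i$th smallest eigenvalue, counted with multiplicity. For the symmetric positive definite matrix $A$, $\|\mathbf{v}\|_{A}=\sqrt{\mathbf{v}^{T}A\mathbf{v}}$ for $\mathbf{v}\in\mathbb{R}^{n}$, and $\|B\|_{A}=\max_{\mathbf{v}\neq 0}\|B\mathbf{v}\|_{A}/\|\mathbf{v}\|_{A}$ for $B\in\mathbb{R}^{n\times n}$. *)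

(* Defs.v *)
From mathcomp Require Import all_boot all_order all_algebra.
From mathcomp Require Import polyrcf.
From mathcomp Require Import all_classical all_reals all_analysis.

Set Implicit Arguments.
Unset Strict Implicit.
Unset Printing Implicit Defensive.

Import Order.TTheory GRing.Theory Num.Theory.
Import numFieldTopology.Exports numFieldNormedType.Exports.

Local Open Scope classical_set_scope.
Local Open Scope ring_scope.

Definition quadform (R : realType) (n : nat) (A : 'M[R]_n) (v : 'cV[R]_n) : R :=
  (v^T *m A *m v) 0 0.

Definition spd (R : realType) (n : nat) (A : 'M[R]_n) : Prop :=
  A^T = A /\ forall v : 'cV[R]_n, v != 0 -> 0 < quadform A v.

Definition vnorm (R : realType) (n : nat) (A : 'M[R]_n) (v : 'cV[R]_n) : R :=
  Num.sqrt (quadform A v).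

(* For n > 0 and A symmetric positive definite this supremum is a maximum:
   see [mnorm_max]. *)
Definition mnorm (R : realType) (n : nat) (A B : 'M[R]_n) : R :=
  sup [set vnorm A (B *m v) / vnorm A v | v in [set v : 'cV[R]_n | v != 0]].

(* [rootsR p] is the increasing list of the distinct roots of p in R, and
   [mup x p] the multiplicity of x as a root of p. *)
Definition eigenvalues (R : realType) (n : nat) (M : 'M[R]_n) : seq R :=
  flatten [seq nseq (mup x (char_poly M)) x | x <- rootsR (char_poly M)].

(* Eigenvalues are numbered from 1. This is only meaningful if M has real
   spectrum and 1 <= i <= n: see [lambdaE]. *)
Definition lambda (R : realType) (n : nat) (i : nat) (M : 'M[R]_n) : R :=
  nth 0 (eigenvalues M) i.-1.

Definition sym_smoother (R : realType) (k : nat) (As Ms : 'M[R]_k) : 'M[R]_k :=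
  Ms^T *m invmx (Ms + Ms^T - As) *m Ms.

Definition coarse_proj (R : realType) (n k : nat) (A : 'M[R]_n)
    (P : 'M[R]_(n, k)) : 'M[R]_n :=
  P *m invmx (P^T *m A *m P) *m P^T *m A.

Definition two_level (R : realType) (n ns nc : nat) (A : 'M[R]_n)
    (S : 'M[R]_(n, ns)) (Ms : 'M[R]_ns) (P : 'M[R]_(n, nc)) : 'M[R]_n :=
  (1%:M - S *m invmx Ms^T *m S^T *m A) *m (1%:M - coarse_proj A P)
    *m (1%:M - S *m invmx Ms *m S^T *m A).

(* [mxalgebra] compares row spaces. *)
Definition colspace_sub (R : realType) (n k l : nat) (P : 'M[R]_(n, k))
    (Q : 'M[R]_(n, l)) : Prop :=
  (P^T <= Q^T)%MS.

Lemma colspace_subP (R : realType) (n k l : nat) (P : 'M[R]_(n, k))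
    (Q : 'M[R]_(n, l)) :
  colspace_sub P Q <->
  [set P *m x | x in [set: 'cV[R]_k]] `<=` [set Q *m y | y in [set: 'cV[R]_l]].
Proof.
split=> [/submxP[D PQ] _ [x _ <-]|sPQ].
  exists (D^T *m x) => //.
  by rewrite mulmxA -[Q]trmxK -trmx_mul -PQ trmxK.
apply/row_subP => i.
have [|y _ Qy] := sPQ (col i P); first by exists (delta_mx i 0) => //; rewrite colE.
by rewrite -tr_col -Qy trmx_mul submxMl.
Qed.

Lemma lambdaE (R : realType) (n : nat) (M : 'M[R]_n) (s : seq R) (i : nat) :
  sorted <=%R s -> char_poly M = \prod_(x <- s) ('X - x%:P) ->
  lambda i M = nth 0 s i.-1.
Proof.
move=> s_sorted ME; rewrite /lambda; congr nth.
have p0 : char_poly M != 0 by rewrite monic_neq0 ?char_poly_monic.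
have memr x : (x \in rootsR (char_poly M)) = (x \in s).
  by rewrite -(roots_on_rootsR p0) in_itv /= ME root_prod_XsubC.
rewrite /eigenvalues.
have : sorted <%R (rootsR (char_poly M)) by exact: sorted_roots.
move: (rootsR _) memr => r memr r_sorted.
have -> : [seq nseq (mup x (char_poly M)) x | x <- r]
        = [seq nseq (count_mem x s) x | x <- r].
  by apply: eq_map => x; rewrite ME mu_prod_XsubC.
apply: (@sorted_eq _ <=%R) => //; [exact: le_trans|exact: le_anti| |].
- rewrite (sorted_pairwise le_trans).
  move: r_sorted; rewrite (sorted_pairwise lt_trans).
  elim: r {memr} => //= x r IH /andP[xr /IH{}IH].
  rewrite pairwise_cat IH andbT; apply/andP; split.
    apply/allrelP => y z /nseqP[-> _] /flatten_mapP[t tr /nseqP[-> _]].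
    by apply/ltW/(allP xr).
  by elim: (count_mem x s) => //= k ->; rewrite andbT; apply/allP => y /nseqP[->].
- have r_uniq := lt_sorted_uniq r_sorted.
  apply/allP => x _ /=; apply/eqP.
  have -> : count_mem x s = if x \in r then count_mem x s else 0%N.
    by rewrite memr; case: ifPn => // xs; apply/count_memPn.
  elim: r r_uniq {memr r_sorted} => //= y r IH /andP[yr /IH{}IH].
  rewrite count_cat IH count_nseq in_cons /= [y == x]eq_sym.
  by case: eqVneq => [->|_] /=; rewrite ?(negbTE yr) ?mul1n ?addn0.
Qed.

Lemma mnorm_max (R : realType) (n : nat) (A B : 'M[R]_n) :
  (0 < n)%N -> spd A ->
  (exists2 v : 'cV[R]_n, v != 0 & vnorm A (B *m v) / vnorm A v = mnorm A B) /\
  (forall v : 'cV[R]_n, v != 0 -> vnorm A (B *m v) / vnorm A v <= mnorm A B).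
Proof.
case: n A B => // n A B _ [_ Apos].
pose f (v : 'cV[R]_n.+1) := vnorm A (B *m v) / vnorm A v.
have fZ a v : a != 0 -> f (a *: v) = f v.
  move=> a0; rewrite /f -scalemxAr.
  have vZ w : vnorm A (a *: w) = `|a| * vnorm A w.
    rewrite /vnorm /quadform -scalemxAr [(_ *: _)^T]linearZ /= -!scalemxAl scalerA mxE.
    by rewrite -expr2 sqrtrM ?sqr_ge0 // sqrtr_sqr.
  by rewrite !vZ -mulf_div divff ?mul1r // normr_eq0.
have q_cont (C : 'M[R]_n.+1) :
    continuous (fun u : 'rV[R]_n.+1 => (u *m C *m u^T) 0 0).
  have -> : (fun u : 'rV[R]_n.+1 => (u *m C *m u^T) 0 0) =
            (fun u => \sum_j (\sum_k u 0 k * C k j) * u 0 j).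
    by apply/funext => u; rewrite mxE; apply: eq_bigr => j _; rewrite !mxE.
  have sum_cont (I : Type) (r : seq I) (g : I -> 'rV[R]_n.+1 -> R) :
      (forall i, continuous (g i)) -> continuous (fun u => \sum_(i <- r) g i u).
    move=> gc; elim: r => [|i r IH] u.
      rewrite (_ : (fun w => _) = fun=> 0); last first.
        by apply/funext => w; rewrite big_nil.
      exact: cst_continuous.
    rewrite (_ : (fun w => _) = g i \+ fun w => \sum_(i <- r) g i w); last first.
      by apply/funext => w; rewrite big_cons.
    by apply: continuousD; [exact: gc|exact: IH].
  apply: (sum_cont) => j u; apply: continuousM; last exact: coord_continuous.
  apply: (sum_cont _ _ (fun k u => u 0 k * C k j)) => k w.
  by apply: continuousM; [exact: coord_continuous|exact: cst_continuous].
have nZ a (u : 'rV[R]_n.+1) : `|a *: u| = `|a| * `|u| by exact: mx_normZ.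
pose K := [set u : 'rV[R]_n.+1 | `|u| = 1].
have K0 : K !=set0.
  have u0 : const_mx 1 != 0 :> 'rV[R]_n.+1.
    by apply/eqP => /matrixP/(_ 0 0)/eqP; rewrite !mxE oner_eq0.
  exists (`|const_mx 1 : 'rV[R]_n.+1|^-1 *: const_mx 1) => /=.
  by rewrite /K /= nZ normfV normr_id mulVf // normr_eq0.
have Kcomp : compact K.
  apply: bounded_closed_compact.
    by exists 1; split => // x x1 u /= ->; exact: ltW.
  apply: (closed_comp (f := fun u : 'rV[R]_n.+1 => `|u|) (D := [set 1])).
    by move=> u _; exact: norm_continuous.
  exact: closed_eq.
have K_neq0 u : K u -> u^T != 0.
  rewrite /K /= => u1; rewrite trmx_eq0 -normr_eq0 u1.
  exact: oner_neq0.
have fcont : {within K, continuous (fun u => f u^T)}.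
  apply: continuous_in_subspaceT => u /set_mem Ku.
  have sq C : {for u, continuous (fun w : 'rV[R]_n.+1 => Num.sqrt ((w *m C *m w^T) 0 0))}.
    by apply: (continuous_comp (q_cont C u)); exact: sqrt_continuous.
  pose BAB := B^T *m A *m B.
  have -> : (fun u : 'rV[R]_n.+1 => f u^T) =
      (fun u => Num.sqrt ((u *m BAB *m u^T) 0 0) / Num.sqrt ((u *m A *m u^T) 0 0)).
    by apply/funext => w; rewrite /f /vnorm /quadform trmx_mul trmxK !mulmxA.
  apply: (continuousM (sq BAB)); apply: continuousV; last exact: sq.
  by rewrite sqrtr_eq0 -ltNge; have := Apos _ (K_neq0 _ Ku); rewrite /quadform trmxK.
have [c /set_mem cK cmax] := EVT_max_rV K0 Kcomp fcont.
have c0 := K_neq0 _ cK.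
have fmax v : v != 0 -> f v <= f c^T.
  move=> v0; have vT0 : `|v^T| != 0 by rewrite normr_eq0 trmx_eq0.
  have /cmax : `|v^T|^-1 *: v^T \in K.
    by apply/mem_set; rewrite /K /= nZ normfV normr_id mulVf.
  by rewrite linearZ /= trmxK fZ // invr_eq0.
have supE : mnorm A B = f c^T.
  apply/eqP; rewrite eq_le; apply/andP; split.
    by apply: ge_sup; [exists (f c^T), c^T|move=> _ [v v0 <-]; exact: fmax].
  apply: ub_le_sup; last by exists c^T.
  by exists (f c^T) => _ [v v0 <-]; exact: fmax.
by split; [exists c^T|move=> v v0; rewrite supE; exact: fmax].
Qed.

(* Main.v *)
Require Import Defs.
From mathcomp Require Import all_boot all_order all_algebra.
From mathcomp Require Import polyrcf ring lra zify.
From mathcomp Require Import all_classical all_reals all_analysis.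

(** Work in the inner product of [A].  Put [D = 1 - Pi_A], the orthogonal
    projection along the coarse space, [G = 1 - S Ms^-1 S^T A] and [G'] its
    adjoint [1 - S Ms^-T S^T A]; then [E = G' D G] is self-adjoint and positive
    semidefinite.

    The norm as an eigenvalue.  For such an operator the norm [c] is itself an
    eigenvalue: a vector at which the norm is attained is an eigenvector
    ([mnorm_eigenvalue]), and compactness provides one ([mnorm_max]).

    The smoothed coarse complement.  One computes [G G' = 1 - T] with
    [T = S B S^T A] and [B] the inverse of the symmetrized smoother.  Passing
    from [G' D G] to [D G G' D] shows that a nonzero number [a] is an eigenvalue
    of [E] exactly when [1 - a] is one of [D T] on the range of [D]; if the norm
    is [0] then [D G = 0] and [D T] is the identity there.  The nonzero
    eigenvalues of [D T] on the range of [D] are those of [N = B S^T A D S]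
    ([two_level_root]).  On the range of [D] the operator [D T] is
    positive definite, because the columns of [S] and [P] together span the whole
    space.  Hence the real eigenvalues of [N] are nonnegative and [1 - c] is the
    least positive one.

    The index.  It remains to count how often [0] is an eigenvalue of [N].
    Factor [D = W V] through its rank [r = n - nc]; then [N] is
    [(B S^T A W)(V S)], and exchanging the two factors gives an [r] by [r]
    matrix, nonsingular by the positivity just used.  Since
    [char_poly (X Y) * 'X^r = 'X^ns * char_poly (Y X)], the multiplicity is
    [ns - r = ns + nc - n], so [1 - c] is the next eigenvalue in increasing
    order ([mnorm_two_level]).

    The comparison.  A larger coarse space has a smaller complement, so
    [Dh D = Dh], and [Dh] is a contraction; evaluating the quadratic form
    [<Eh v, v> = |Dh G v|^2 <= |D G v|^2 = <E v, v>] at a top eigenvector of [Eh]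
    compares the norms ([mnorm_two_level_mono]). *)

Set Implicit Arguments.
Unset Strict Implicit.
Unset Printing Implicit Defensive.

Import Order.TTheory GRing.Theory Num.Theory.

Local Open Scope ring_scope.

(** * Characteristic polynomials and their roots *)

(** Both sides arise from the determinant of [[t, X; Y, 1]]: clearing [Y] by
    column operations gives the left factor, clearing it by row operations,
    after scaling the lower rows by [t], gives the right one. *)
Lemma char_poly_mulmxC (R : comNzRingType) (m r : nat)
    (X : 'M[R]_(m, r)) (Y : 'M[R]_(r, m)) :
  char_poly (X *m Y) * 'X^r = 'X^m * char_poly (Y *m X).
Proof.
pose x : 'M[{poly R}]_(m, r) := map_mx polyC X.
pose y : 'M[{poly R}]_(r, m) := map_mx polyC Y.
pose B := block_mx ('X%:M : 'M[{poly R}]_m) x y (1%:M : 'M[{poly R}]_r).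
have detB : char_poly (X *m Y) = \det B.
  have det_elim : \det (block_mx (1%:M : 'M[{poly R}]_m) 0 (- y)
                                 (1%:M : 'M[{poly R}]_r)) = 1.
    by rewrite det_lblock !det1 mulr1.
  rewrite -[RHS]mulr1 -[X in _ * X]det_elim -det_mulmx mulmx_block.
  rewrite !mulmx1 !mulmx0 !mul1mx subrr add0r.
  by rewrite add0r det_ublock det1 mulr1 mulmxN -map_mxM.
have := det_mulmx (block_mx 1%:M 0 (- y) ('X%:M : 'M[{poly R}]_r)) B.
rewrite mulmx_block !mul1mx !mul0mx !addr0 mulmx1 det_lblock det1 mul1r det_scalar.
rewrite mul_mx_scalar mul_scalar_mx scalerN addNr.
rewrite det_ublock det_scalar mulNmx -map_mxM addrC -detB => detE.
by rewrite mulrC -detE.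
Qed.

(** Library eigenvectors are rows, whereas the operators here act on columns. *)
Lemma char_poly_rootP (F : fieldType) (n : nat) (M : 'M[F]_n) (a : F) :
  reflect (exists2 x : 'cV_n, x != 0 & M *m x = a *: x) (root (char_poly M) a).
Proof.
have -> : char_poly M = char_poly M^T.
  by rewrite /char_poly -det_tr /char_poly_mx linearB /= tr_scalar_mx map_trmx.
rewrite -eigenvalue_root_char.
apply: (iffP eigenvalueP) => [[v vM v0]|[x x0 Mx]].
  exists v^T; first by rewrite trmx_eq0.
  by rewrite -[M]trmxK -trmx_mul vM linearZ.
by exists x^T; rewrite ?trmx_eq0 // -trmx_mul Mx linearZ.
Qed.

(** When no root lies in [(-oo, 0)] or in [(0, mu)], the increasing list of
    eigenvalues starts with the zeros, immediately followed by [mu].  Complex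
    eigenvalues do not enter, since only real roots are listed. *)
Lemma lambda_least_positive (R : realType) (n : nat) (M : 'M[R]_n) (mu : R) :
  0 < mu -> root (char_poly M) mu ->
  (forall x, root (char_poly M) x -> x = 0 \/ mu <= x) ->
  lambda (mup 0 (char_poly M) + 1) M = mu.
Proof.
move=> mu0 rmu rM; rewrite /lambda addn1 /= /eigenvalues.
have p0 : char_poly M != 0 by rewrite monic_neq0 ?char_poly_monic.
have memr x : (x \in rootsR (char_poly M)) = root (char_poly M) x.
  by rewrite -(roots_on_rootsR p0) in_itv.
have mupE x : (0 < mup x (char_poly M))%N = root (char_poly M) x.
  by rewrite -XsubC_dvd // dvdp_XsubCl.
have : sorted <%R (rootsR (char_poly M)) by exact: sorted_roots.
have nth_hd k s : (0 < k)%N -> nth 0 (nseq k mu ++ s) 0 = mu by case: k.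
have head_mu s : sorted <%R s -> mu \in s -> (forall x, x \in s -> mu <= x) ->
    exists s', s = mu :: s'.
  case: s => // y s /= ys mus smu; exists s; congr (_ :: _).
  apply/eqP; rewrite eq_le smu ?mem_head // andbT.
  move: mus; rewrite inE => /orP[/eqP->//|mus].
  by apply/ltW/(allP (order_path_min lt_trans ys)).
move: (rootsR _) memr => s memr ss.
have mus : mu \in s by rewrite memr.
have [r0|nr0] := boolP (root (char_poly M) 0).
- case: s ss memr mus => // y s ss memr mus.
  have y0 : y = 0.
    have [//|muy] := rM y (eq_trans (esym (memr y)) (mem_head _ _)).
    have : 0 \in y :: s by rewrite memr.
    rewrite inE => /orP[/eqP//|/(allP (order_path_min lt_trans ss))] y0.
    by have := lt_trans mu0 (le_lt_trans muy y0); rewrite ltxx.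
  move: ss memr mus; rewrite {}y0 => ss memr mus.
  have [|||s' ->] := head_mu s.
  + exact: path_sorted ss.
  + by move: mus; rewrite inE gt_eqF.
  + move=> x xs; have := allP (order_path_min lt_trans ss) _ xs.
    have [|->|//] := rM x; last by rewrite ltxx.
    by rewrite -memr inE xs orbT.
  by rewrite /= nth_cat size_nseq ltnn subnn nth_hd // mupE.
- have [|s' ->] := head_mu s ss mus.
    move=> x; rewrite memr => rx; have [x0|//] := rM x rx.
    by rewrite x0 (negbTE nr0) in rx.
  by rewrite (mupNroot nr0) /= nth_hd // mupE.
Qed.

(** * Self-adjoint operators in the inner product of an SPD matrix *)

Definition inner (R : realType) (n : nat) (A : 'M[R]_n) (u v : 'cV[R]_n) : R :=
  (u^T *m A *m v) 0 0.

(** [G] is the adjoint [A^-1 F^T A] of [F] for [inner A], written without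
    inverting [A]. *)
Definition adjoint (R : realType) (n : nat) (A F G : 'M[R]_n) : Prop :=
  F^T *m A = A *m G.

Section InnerProduct.
Context {R : realType} {n : nat} (A : 'M[R]_n).
Implicit Types u v w : 'cV[R]_n.

Lemma quadformE v : quadform A v = inner A v v.
Proof. by []. Qed.

Lemma innerBl u v w : inner A (u - v) w = inner A u w - inner A v w.
Proof. by rewrite /inner linearB /= !mulmxBl !mxE. Qed.

Lemma innerBr u v w : inner A u (v - w) = inner A u v - inner A u w.
Proof. by rewrite /inner mulmxBr !mxE. Qed.

Lemma innerZl a u v : inner A (a *: u) v = a * inner A u v.
Proof. by rewrite /inner linearZ /= -!scalemxAl mxE. Qed.

Lemma innerZr a u v : inner A u (a *: v) = a * inner A u v.
Proof. by rewrite /inner -scalemxAr mxE. Qed.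

Lemma inner_adjoint F G u v : adjoint A F G ->
  inner A (F *m u) v = inner A u (G *m v).
Proof. by move=> FG; rewrite /inner trmx_mul -[_ *m F^T *m A]mulmxA FG !mulmxA. Qed.

Lemma innerC u v : A^T = A -> inner A u v = inner A v u.
Proof.
move=> sA; rewrite /inner -[in LHS](trmxK (_ *m v)) [LHS]mxE.
by rewrite !trmx_mul trmxK sA mulmxA.
Qed.

Lemma adjointC F G : A^T = A -> adjoint A F G -> adjoint A G F.
Proof.
by move=> sA /(congr1 trmx); rewrite /adjoint !trmx_mul trmxK sA => <-.
Qed.

Lemma quadform_ge0 v : spd A -> 0 <= quadform A v.
Proof.
move=> [_ A0]; have [->|/A0/ltW//] := eqVneq v 0.
by rewrite /quadform mulmx0 mxE.
Qed.

Lemma quadform_le0 v : spd A -> quadform A v <= 0 -> v = 0.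
Proof.
by move=> [_ A0] v0; apply/eqP/negP => /negP /A0; rewrite ltNge v0.
Qed.

Lemma spd_unitmx : spd A -> A \in unitmx.
Proof.
move=> sA; rewrite -row_free_unit -kermx_eq0; apply/eqP/row_matrixP => i.
rewrite row0 -[LHS]trmxK [X in X^T](_ : _ = 0) ?trmx0 //.
apply: (quadform_le0 sA).
by rewrite /quadform trmxK -row_mul mulmx_ker row0 mul0mx mxE.
Qed.

Lemma mnorm_ge0 B : (0 < n)%N -> spd A -> 0 <= mnorm A B.
Proof.
move=> n0 sA; have [v _ <-] := (mnorm_max B n0 sA).1.
by rewrite divr_ge0 ?sqrtr_ge0.
Qed.

Lemma quadform_mnorm B v : (0 < n)%N -> spd A ->
  quadform A (B *m v) <= mnorm A B ^+ 2 * quadform A v.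
Proof.
move=> n0 sA; have [->|v0] := eqVneq v 0.
  by rewrite mulmx0 /quadform mulmx0 mxE mulr0.
have := (mnorm_max B n0 sA).2 v v0.
have qv : 0 < quadform A v by exact: sA.2.
rewrite ler_pdivrMr ?sqrtr_gt0 // => le.
rewrite -[leLHS]sqr_sqrtr ?quadform_ge0 // -[quadform A v]sqr_sqrtr ?quadform_ge0 //.
by rewrite -exprMn ler_sqr ?nnegrE ?mulr_ge0 ?sqrtr_ge0 ?mnorm_ge0.
Qed.

Lemma mnorm_attained B : (0 < n)%N -> spd A ->
  exists2 v, v != 0 & quadform A (B *m v) = mnorm A B ^+ 2 * quadform A v.
Proof.
move=> n0 sA; have [v v0 vB] := (mnorm_max B n0 sA).1.
exists v => //; have qv : 0 < quadform A v by exact: sA.2.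
rewrite -vB expr_div_n !sqr_sqrtr ?quadform_ge0 // divfK //.
by rewrite gt_eqF.
Qed.

Lemma eigenvalue_le_mnorm B a v : (0 < n)%N -> spd A ->
  v != 0 -> B *m v = a *: v -> a <= mnorm A B.
Proof.
move=> n0 sA v0 Bv; apply: le_trans (ler_norm a) _.
have := quadform_mnorm B v n0 sA.
rewrite Bv !quadformE innerZl innerZr mulrA -expr2 ler_pM2r ?(sA.2 v) //.
by rewrite -[a ^+ 2]real_normK ?num_real // ler_sqr ?nnegrE ?mnorm_ge0.
Qed.

(** Let [c] be the norm and [v] a vector where it is attained.  Expanding
    [|E (E v) - c^2 v|^2] and using [|E (E v)| <= c |E v| = c^2 |v|] shows that
    it is nonpositive, so [(E + c) (E - c) v = 0].  Positivity of [E] excludes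
    the eigenvalue [-c] unless [c = 0], leaving [E v = c v]. *)
Lemma mnorm_eigenvalue E : (0 < n)%N -> spd A -> adjoint A E E ->
  (forall v, 0 <= inner A (E *m v) v) ->
  exists2 v : 'cV_n, v != 0 & E *m v = mnorm A E *: v.
Proof.
move=> n0 sA EE E0; have [v v0 Ev] := mnorm_attained E n0 sA.
exists v => //; set c := mnorm A E in Ev *.
have E2v : E *m (E *m v) = c ^+ 2 *: v.
  apply/eqP; rewrite -subr_eq0; apply/eqP; apply: (quadform_le0 sA).
  have := quadform_mnorm E (E *m v) n0 sA.
  rewrite -/c Ev [in X in _ -> X]quadformE !(innerBl, innerBr, innerZl, innerZr).
  rewrite (innerC v _ sA.1) (inner_adjoint (E *m v) v EE) -!quadformE Ev => le.
  by rewrite -subr_ge0 in le; rewrite -subr_ge0; move: le; congr (_ <= _); ring.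
apply/eqP; rewrite -subr_eq0; apply/eqP; apply: (quadform_le0 sA).
have [c0|c0] := eqVneq c 0.
  by rewrite c0 scale0r subr0 Ev c0 expr0n mul0r.
have cp : 0 < c by rewrite lt_def c0 mnorm_ge0.
(* u := E v - c v satisfies (E + c) u = 0. *)
have Eu : E *m (E *m v - c *: v) = - c *: (E *m v - c *: v).
  rewrite mulmxBr E2v -scalemxAr scalerBr scalerA scaleNr mulNr scaleNr opprK.
  by rewrite addrC -expr2.
have := E0 (E *m v - c *: v); rewrite Eu innerZl mulNr oppr_ge0.
by rewrite pmulr_rle0.
Qed.

(** A form of the Cauchy-Schwarz inequality: with [c] the norm of [E],
    expanding [0 <= |E v - c v|^2] and using [|E v| <= c |v|] bounds
    [2 c <E v, v>]. *)
Lemma inner_le_mnorm E v : (0 < n)%N -> spd A ->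
  inner A (E *m v) v <= mnorm A E * quadform A v.
Proof.
move=> n0 sA; have le := quadform_mnorm E v n0 sA.
set c := mnorm A E in le *; have c0 : 0 <= c by exact: mnorm_ge0.
have [cz|cz] := eqVneq c 0.
  rewrite cz expr0n mul0r in le.
  by rewrite (quadform_le0 sA le) /inner trmx0 !mul0mx mxE cz mul0r.
have cp : 0 < c by rewrite lt_def cz.
have := quadform_ge0 (E *m v - c *: v) sA.
move: le; rewrite !quadformE.
rewrite !(innerBl, innerBr, innerZl, innerZr) (innerC v _ sA.1).
set t := inner A (E *m v) (E *m v); set s := inner A (E *m v) v.
set q := inner A v v => le h; rewrite -(ler_pM2l cp); lra.
Qed.

End InnerProduct.

(** * The iteration operator of an abstract two-level method *)

Lemma mup0_char_poly_mulmx (F : fieldType) (m r : nat)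
    (X : 'M[F]_(m, r)) (Y : 'M[F]_(r, m)) :
  ~~ root (char_poly (Y *m X)) 0 -> mup 0 (char_poly (X *m Y)) = (m - r)%N.
Proof.
move=> nr; have p0 k (C : 'M[F]_k) : char_poly C != 0.
  by rewrite monic_neq0 ?char_poly_monic.
have x0 k : 'X^k != 0 :> {poly F} by rewrite monic_neq0 ?monicXn.
have muX k : mup 0 ('X^k : {poly F}) = k.
  by rewrite -['X]subr0 mup_XsubCX eqxx.
have := congr1 (mup 0) (char_poly_mulmxC X Y).
by rewrite !mupM // !muX (mupNroot nr) addn0 => /(canRL (addnK r)).
Qed.

Lemma mulmx_cV_neq0 (F : fieldType) (m r : nat) (M : 'M[F]_(m, r)) :
  M != 0 -> exists x : 'cV_r, M *m x != 0.
Proof.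
move=> /matrix0Pn[i [j Mij]]; exists (delta_mx j 0); rewrite -colE.
by apply/matrix0Pn; exists i, 0; rewrite mxE.
Qed.

Lemma quadform_proj_le (R : realType) (n : nat) (A D : 'M[R]_n) (y : 'cV[R]_n) :
  spd A -> adjoint A D D -> D *m D = D -> quadform A (D *m y) <= quadform A y.
Proof.
move=> spdA DD DxD; have := quadform_ge0 (y - D *m y) spdA.
rewrite !quadformE !(innerBl, innerBr) (innerC y _ spdA.1).
by rewrite (inner_adjoint _ (D *m y) DD) mulmxA DxD -(inner_adjoint _ _ DD); lra.
Qed.

(** The sole facts about the method that matter: [D] is an orthogonal projection,
    [G'] is the adjoint of [G], and [G G'] differs from the identity by a
    positive definite correction through [S]. *)
Section TwoLevelOperator.
Context {R : realType} {n ns : nat}.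
Context (A D G G' : 'M[R]_n) (S : 'M[R]_(n, ns)) (B : 'M[R]_ns).
Hypotheses (n_gt0 : (0 < n)%N) (spdA : spd A).
Hypotheses (GG' : adjoint A G G') (DD : adjoint A D D) (DxD : D *m D = D).

Let E := G' *m D *m G.
Let T := S *m B *m S^T *m A.
Let N := B *m S^T *m A *m D *m S.

Lemma inner_two_level v : inner A (E *m v) v = quadform A (D *m G *m v).
Proof.
rewrite quadformE /E -!mulmxA (inner_adjoint _ _ (adjointC spdA.1 GG')).
by rewrite -{1}DxD -mulmxA (inner_adjoint _ _ DD).
Qed.

Lemma two_level_psd v : 0 <= inner A (E *m v) v.
Proof. by rewrite inner_two_level quadform_ge0. Qed.

Lemma two_level_adjoint : adjoint A E E.
Proof.
rewrite /adjoint /E !trmx_mul -!mulmxA (adjointC spdA.1 GG').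
by rewrite (mulmxA D^T) DD (mulmxA G^T) (mulmxA G^T) GG' !mulmxA.
Qed.

Hypothesis GxG' : G *m G' = 1%:M - T.
Hypothesis B_gt0 : forall y : 'cV_ns, y != 0 -> 0 < quadform B y.
(* The A-orthogonal complements of the coarse space and of the columns of S meet
   only in 0. *)
Hypothesis S_compl : forall w : 'cV_n, D *m w = w -> S^T *m A *m w = 0 -> w = 0.

Lemma smoother_form_gt0 (w : 'cV_n) :
  w != 0 -> D *m w = w -> 0 < inner A (D *m T *m w) w.
Proof.
move=> w0 Dw; rewrite -mulmxA (inner_adjoint _ _ DD) Dw.
have -> : inner A (T *m w) w = quadform B (S^T *m A *m w).
  rewrite (innerC _ _ spdA.1) /inner /quadform /T !trmx_mul trmxK spdA.1.
  by rewrite !mulmxA.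
by apply: B_gt0; apply: contra_neq w0; exact: S_compl.
Qed.

Lemma smoother_eigen_gt0 mu (w : 'cV_n) :
  w != 0 -> D *m w = w -> D *m T *m w = mu *: w -> 0 < mu.
Proof.
move=> w0 Dw DTw; have := smoother_form_gt0 w0 Dw.
by rewrite DTw innerZl pmulr_lgt0 // (spdA.2 _ w0).
Qed.

(** If [1 - mu] is positive, [G' w] is a nonzero eigenvector of [E] for it. *)
Lemma smoother_eigen_mnorm mu (w : 'cV_n) :
  w != 0 -> D *m w = w -> D *m T *m w = mu *: w -> 1 - mu <= mnorm A E.
Proof.
move=> w0 Dw DTw.
have DGG'w : D *m (G *m (G' *m w)) = (1 - mu) *: w.
  by rewrite (mulmxA G) GxG' mulmxBl mul1mx mulmxBr Dw mulmxA DTw scalerBl scale1r.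
have [le0|gt0] := leP (1 - mu) 0; first exact: le_trans le0 (mnorm_ge0 _ n_gt0 spdA).
apply: (@eigenvalue_le_mnorm _ _ _ _ _ (G' *m w)) => //.
  apply: contraTneq gt0 => G'w0; move: DGG'w; rewrite G'w0 !mulmx0 => /esym/eqP.
  by rewrite scaler_eq0 (negbTE w0) orbF => /eqP ->; rewrite ltxx.
by rewrite /E -!mulmxA DGG'w scalemxAr.
Qed.

(** If [v] is a top eigenvector of [E], then [w = D G v] is the eigenvector.
    This [w] vanishes when the norm is [0]; but then [D G = 0], so [D T = D] and
    any nonzero vector of the range of [D] will do. *)
Lemma mnorm_smoother_eigen : D != 0 ->
  exists w : 'cV_n, [/\ w != 0, D *m w = w & D *m T *m w = (1 - mnorm A E) *: w].
Proof.
move=> D0; have [v v0 Ev] :=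
  mnorm_eigenvalue n_gt0 spdA two_level_adjoint two_level_psd.
set c := mnorm A E in Ev *.
have DTE w : D *m w = w -> D *m T *m w = w - D *m G *m (G' *m w).
  move=> Dw; rewrite mulmxA -(mulmxA D G) GxG' mulmxBr mulmx1 mulmxBl Dw.
  by rewrite opprB addrC subrK.
have [c0|c0] := eqVneq c 0.
  have DG0 : D *m G = 0.
    apply: contra_eq c0 => /mulmx_cV_neq0[u DGu]; rewrite gt_eqF //.
    rewrite -(pmulr_lgt0 _ (spdA.2 u _)); last first.
      by apply: contraNneq DGu => ->; rewrite mulmx0.
    apply: lt_le_trans (inner_le_mnorm _ _ n_gt0 spdA).
    by rewrite inner_two_level; exact: spdA.2.
  have [u Du] := mulmx_cV_neq0 D0; exists (D *m u).
  by rewrite c0 subr0 scale1r DTE mulmxA DxD // DG0 mul0mx subr0.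
exists (D *m G *m v); split.
- apply: contraNneq c0 => w0; move: Ev; rewrite /E -!mulmxA (mulmxA D) w0 mulmx0.
  by move=> /esym/eqP; rewrite scaler_eq0 (negbTE v0) orbF.
- by rewrite !mulmxA DxD.
- rewrite DTE ?mulmxA ?DxD //.
  rewrite -(mulmxA (D *m G)) -(mulmxA (D *m G)) -(mulmxA (D *m G) _ v) -/E Ev.
  by rewrite -scalemxAr scalerBl scale1r.
Qed.

(** The eigenvector exchange for the two products
    [N = (B S^T A) (D S)] and [D T = (D S) (B S^T A)], with [D] absorbed by its
    idempotence. *)
Lemma two_level_root mu : mu != 0 ->
  root (char_poly N) mu <->
  exists w : 'cV_n, [/\ w != 0, D *m w = w & D *m T *m w = mu *: w].
Proof.
move=> mu0; split=> [/char_poly_rootP[x x0 Nx]|[w [w0 Dw DTw]]].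
  have DTDS : D *m T *m (D *m S *m x) = mu *: (D *m S *m x).
    by rewrite scalemxAr -Nx /N /T !mulmxA.
  exists (D *m S *m x); split=> //; last by rewrite !mulmxA DxD.
  apply: contra_neq x0 => DSx0; apply: (scalerI mu0).
  by rewrite scaler0 -Nx /N -!mulmxA (mulmxA D) DSx0 !mulmx0.
apply/char_poly_rootP; exists (B *m S^T *m A *m w).
  apply: contra_neq w0 => x0; apply: (scalerI mu0); rewrite scaler0 -DTw.
  by move: x0; rewrite /T -!mulmxA => ->; rewrite !mulmx0.
by rewrite scalemxAr -DTw /N /T !mulmxA.
Qed.

(** The rank factorization of [D] through dimension [\rank D] splits [N] into a
    product whose exchanged version represents [D T] on the range of [D], where
    it is positive definite, hence nonsingular. *)
Lemma two_level_mup0 : mup 0 (char_poly N) = (ns - \rank D)%N.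
Proof.
have -> : N = (B *m S^T *m A *m col_base D) *m (row_base D *m S).
  by rewrite /N -{1}(mulmx_base D) !mulmxA.
apply: mup0_char_poly_mulmx; apply/char_poly_rootP => -[z z0].
rewrite scale0r => Kz.
have DW : D *m col_base D = col_base D.
  apply: (row_free_inj (row_base_free D)).
  by rewrite -mulmxA !mulmx_base DxD.
have Dw : D *m (col_base D *m z) = col_base D *m z by rewrite mulmxA DW.
have w0 : col_base D *m z != 0.
  apply: contra_neq z0 => Wz; apply: (row_full_inj (col_base_full D)).
  by rewrite Wz mulmx0.
have := smoother_form_gt0 w0 Dw.
have -> : D *m T *m (col_base D *m z) = col_base D *m (row_base D *m S *m
    (B *m S^T *m A *m col_base D) *m z).
  by rewrite -{1}(mulmx_base D) /T !mulmxA.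
by rewrite Kz mulmx0 /inner trmx0 !mul0mx mxE ltxx.
Qed.

Lemma mnorm_two_level : D != 0 -> mnorm A E = 1 - lambda (ns - \rank D + 1) N.
Proof.
move=> D0; have [w [w0 Dw DTw]] := mnorm_smoother_eigen D0.
have mu_gt0 := smoother_eigen_gt0 w0 Dw DTw.
rewrite -two_level_mup0 (@lambda_least_positive _ _ _ (1 - mnorm A E)) //.
- by rewrite opprB addrC subrK.
- by apply/two_level_root; [rewrite gt_eqF|exists w].
- move=> x rx; have [->|x0] := eqVneq x 0; [by left|right].
  have /two_level_root [//|u [u0 Du DTu]] := rx.
  by have := smoother_eigen_mnorm u0 Du DTu; lra.
Qed.

End TwoLevelOperator.

(** * The coarse-grid projection *)

Section CoarseProjection.
Context {R : realType} {n k : nat} (A : 'M[R]_n) (P : 'M[R]_(n, k)).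
Hypotheses (spdA : spd A) (rankP : \rank P = k).

Lemma galerkin_unitmx : P^T *m A *m P \in unitmx.
Proof.
apply: spd_unitmx; split=> [|v v0].
  by rewrite !trmx_mul trmxK spdA.1 mulmxA.
have -> : quadform (P^T *m A *m P) v = quadform A (P *m v).
  by rewrite /quadform trmx_mul !mulmxA.
apply: spdA.2; apply: contra_neq v0 => Pv.
have freeP : row_free P^T by rewrite /row_free mxrank_tr rankP.
apply: trmx_inj; apply: (row_free_inj freeP).
by rewrite -trmx_mul Pv !trmx0 mul0mx.
Qed.

Lemma coarse_projK : coarse_proj A P *m P = P.
Proof.
rewrite /coarse_proj -(mulmxA _ A) -(mulmxA _ P^T) (mulmxA P^T).
by rewrite mulmxKV ?galerkin_unitmx.
Qed.

Lemma coarse_proj_adjoint : adjoint A (1%:M - coarse_proj A P) (1%:M - coarse_proj A P).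
Proof.
rewrite /adjoint linearB /= mulmxBl mulmxBr tr_scalar_mx mul1mx mulmx1.
rewrite /coarse_proj !trmx_mul trmx_inv !trmx_mul !trmxK spdA.1.
by rewrite !mulmxA.
Qed.

Lemma coarse_compl_idem :
  (1%:M - coarse_proj A P) *m (1%:M - coarse_proj A P) = 1%:M - coarse_proj A P.
Proof.
have PiPi : coarse_proj A P *m coarse_proj A P = coarse_proj A P.
  by rewrite {2}/coarse_proj !mulmxA coarse_projK.
by rewrite mulmxBl mul1mx mulmxBr mulmx1 PiPi subrr subr0.
Qed.

Lemma coarse_compl_orth (w : 'cV_n) :
  (1%:M - coarse_proj A P) *m w = w -> P^T *m A *m w = 0.
Proof.
move=> <-; rewrite -(mulmxA P^T) (mulmxA A) -coarse_proj_adjoint !mulmxA -trmx_mul.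
by rewrite mulmxBl mul1mx coarse_projK subrr trmx0 !mul0mx.
Qed.

(** The ranks of the complementary idempotents [Pi_A] and [1 - Pi_A] add up to
    [n], and [Pi_A P = P] forces [Pi_A] to have the rank of [P]. *)
Lemma rank_coarse_compl : \rank (1%:M - coarse_proj A P) = (n - k)%N.
Proof.
have rankPi : \rank (coarse_proj A P) = k.
  apply/eqP; rewrite eqn_leq; apply/andP; split.
    rewrite /coarse_proj -!mulmxA; apply: leq_trans (mxrankM_maxl _ _) _.
    by rewrite rankP.
  by rewrite -[leqLHS]rankP -{1}coarse_projK mxrankM_maxl.
have PiD : coarse_proj A P *m (1%:M - coarse_proj A P) = 0.
  rewrite -[X in X *m _](subKr 1%:M) mulmxBl mul1mx.
  by rewrite coarse_compl_idem subrr.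
have le := mulmx0_rank_max PiD.
have := mxrank_add (coarse_proj A P) (1%:M - coarse_proj A P).
rewrite addrC subrK mxrank1 => ge; move: le ge; rewrite rankPi; lia.
Qed.

End CoarseProjection.

(** [Pi_A] for [Q] fixes the columns of [P], so it also fixes the range of [Pi_A]
    for [P]. *)
Lemma coarse_compl_mul (R : realType) (n k l : nat) (A : 'M[R]_n)
    (P : 'M[R]_(n, k)) (Q : 'M[R]_(n, l)) :
  spd A -> \rank Q = l -> colspace_sub P Q ->
  (1%:M - coarse_proj A Q) *m (1%:M - coarse_proj A P) = 1%:M - coarse_proj A Q.
Proof.
move=> spdA rankQ /submxP[C PC].
have QP : coarse_proj A Q *m P = P.
  by rewrite -[P]trmxK PC trmx_mul trmxK mulmxA coarse_projK.
rewrite mulmxBr mulmx1 -[RHS]subr0; congr (_ - _).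
by rewrite {2}/coarse_proj !mulmxA mulmxBl mul1mx QP subrr !mul0mx.
Qed.

(** * The smoother *)

Section Smoother.
Context {R : realType} {n ns : nat}.
Context (A : 'M[R]_n) (S : 'M[R]_(n, ns)) (M : 'M[R]_ns).
Hypotheses (spdA : spd A) (unitM : M \in unitmx).
Let K := M + M^T - S^T *m A *m S.
Hypothesis spdK : spd K.

Lemma invmx_sym_smoother :
  invmx (sym_smoother (S^T *m A *m S) M) = invmx M *m K *m invmx M^T.
Proof.
have unitMT : M^T \in unitmx by rewrite unitmx_tr.
have KK := spd_unitmx spdK.
have inv : sym_smoother (S^T *m A *m S) M *m (invmx M *m K *m invmx M^T) = 1%:M.
  by rewrite /sym_smoother -/K !mulmxA mulmxK // mulmxKV // mulmxV.
have [u _] := mulmx1_unit inv.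
by rewrite -[LHS]mulmx1 -inv mulKmx.
Qed.

Lemma sym_smoother_inv_gt0 (y : 'cV_ns) : y != 0 ->
  0 < quadform (invmx (sym_smoother (S^T *m A *m S) M)) y.
Proof.
move=> y0; rewrite invmx_sym_smoother.
have -> : quadform (invmx M *m K *m invmx M^T) y = quadform K (invmx M^T *m y).
  by rewrite /quadform trmx_mul trmx_inv trmxK !mulmxA.
apply: spdK.2; apply: contra_neq y0 => My.
by rewrite -(mulKVmx (m := 1) (_ : M^T \in unitmx) y) ?unitmx_tr // My mulmx0.
Qed.

Lemma smoother_adjoint : adjoint A (1%:M - S *m invmx M *m S^T *m A)
  (1%:M - S *m invmx M^T *m S^T *m A).
Proof.
rewrite /adjoint linearB /= mulmxBl mulmxBr tr_scalar_mx mul1mx mulmx1.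
by rewrite !trmx_mul trmx_inv trmxK spdA.1 !mulmxA.
Qed.

(** Symmetrizing the smoother is exactly what makes one pre- and one
    post-smoothing step combine into a single step of the same form. *)
Lemma smoother_mul_adjoint :
  (1%:M - S *m invmx M *m S^T *m A) *m (1%:M - S *m invmx M^T *m S^T *m A) =
  1%:M - S *m invmx (sym_smoother (S^T *m A *m S) M) *m S^T *m A.
Proof.
have unitMT : M^T \in unitmx by rewrite unitmx_tr.
rewrite invmx_sym_smoother.
have -> : invmx M *m K *m invmx M^T = invmx M + invmx M^T -
    invmx M *m (S^T *m A *m S) *m invmx M^T.
  rewrite /K mulmxBr mulmxDr mulVmx // mulmxBl mulmxDl mul1mx.
  by rewrite mulmxK // [invmx M^T + _]addrC.
rewrite [in RHS]mulmxBr [in RHS]mulmxDr ![in RHS](mulmxBl, mulmxDl).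
by rewrite mulmxBr mulmx1 mulmxBl mul1mx !mulmxA !opprD !opprK !addrA.
Qed.

End Smoother.

(** * The norm of the two-level iteration *)

Lemma mnorm_two_level_prolongation (R : realType) (n ns nc : nat)
    (A : 'M[R]_n) (S : 'M[R]_(n, ns)) (P : 'M[R]_(n, nc)) (M : 'M[R]_ns) :
  spd A -> (nc < n)%N -> \rank P = nc -> \rank (row_mx S P) = n ->
  M \in unitmx -> spd (M + M^T - S^T *m A *m S) ->
  mnorm A (two_level A S M P) = 1 - lambda (ns + nc - n + 1)
    (invmx (sym_smoother (S^T *m A *m S) M) *m S^T *m A *m
       (1%:M - coarse_proj A P) *m S).
Proof.
move=> spdA ltn rankP rankSP unitM spdK.
have rankD := rank_coarse_compl spdA rankP.
rewrite (mnorm_two_level _ spdA (smoother_adjoint S M spdA) (coarse_proj_adjoint P spdA)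
  (coarse_compl_idem spdA rankP) (smoother_mul_adjoint unitM spdK)).
- by rewrite rankD; congr (1 - lambda _ _); lia.
- by lia.
- exact: sym_smoother_inv_gt0.
- move=> w Dw Sw; have Pw := coarse_compl_orth spdA rankP Dw.
  apply: (quadform_le0 spdA).
  have freeSP : row_free (row_mx S P) by rewrite /row_free rankSP.
  have wA_tr k (X : 'M[R]_(n, k)) : w^T *m A *m X = (X^T *m A *m w)^T.
    by rewrite !trmx_mul trmxK spdA.1 mulmxA.
  have wA : w^T *m A = 0.
    apply: (row_free_inj freeSP); rewrite mul0mx mul_mx_row.
    by rewrite !wA_tr Sw Pw !trmx0 row_mx0.
  by rewrite /quadform wA mul0mx mxE.
- by rewrite -mxrank_eq0 rankD; lia.
Qed.

Lemma mnorm_two_level_mono (R : realType) (n ns nc nch : nat)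
    (A : 'M[R]_n) (S : 'M[R]_(n, ns)) (P : 'M[R]_(n, nc)) (Q : 'M[R]_(n, nch))
    (M : 'M[R]_ns) :
  (0 < n)%N -> spd A -> \rank P = nc -> \rank Q = nch -> colspace_sub P Q ->
  mnorm A (two_level A S M Q) <= mnorm A (two_level A S M P).
Proof.
move=> n_gt0 spdA rankP rankQ PQ.
have GG' := smoother_adjoint S M spdA.
have DP := coarse_proj_adjoint P spdA; have DQ := coarse_proj_adjoint Q spdA.
have idP := coarse_compl_idem spdA rankP; have idQ := coarse_compl_idem spdA rankQ.
have [v v0 Ev] := mnorm_eigenvalue n_gt0 spdA (two_level_adjoint spdA GG' DQ)
  (two_level_psd spdA GG' DQ idQ).
have qv : 0 < quadform A v by exact: spdA.2.
rewrite -(ler_pM2r qv) [leLHS](_ : _ = inner A (two_level A S M Q *m v) v); last first.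
  by rewrite Ev innerZl.
apply: le_trans (inner_le_mnorm _ _ n_gt0 spdA).
rewrite !inner_two_level // -{1}(coarse_compl_mul spdA rankQ PQ) -mulmxA -mulmxA.
rewrite -(mulmxA (1%:M - coarse_proj A P)).
exact: quadform_proj_le.
Qed.

Unset Implicit Arguments.

Theorem theorem3p6 (R : realType) (n ns nc nch : nat)
    (A : 'M[R]_n) (S : 'M[R]_(n, ns)) (P : 'M[R]_(n, nc))
    (Ms : 'M[R]_ns) (Ph : 'M[R]_(n, nch))
    (hA : spd A)
    (hns : (ns <= n)%N) (hnc : (nc < n)%N)
    (hS : \rank S = ns) (hP : \rank P = nc)
    (hSP : \rank (row_mx S P) = n)
    (hSI : forall e : ns = n, castmx (erefl n, e) S = 1%:M)
    (hMs : Ms \in unitmx)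
    (hMsA : spd (Ms + Ms^T - S^T *m A *m S))
    (hnch : (nc <= nch < n)%N)
    (hPh : \rank Ph = nch)
    (hSPh : \rank (row_mx S Ph) = n)
    (hsub : colspace_sub P Ph) :
  let Mst := sym_smoother (S^T *m A *m S) Ms in
  let E := two_level A S Ms P in
  let Eh := two_level A S Ms Ph in
  [/\ mnorm A Eh <= mnorm A E,
      mnorm A Eh = 1 - lambda (ns + nch - n + 1)
        (invmx Mst *m S^T *m A *m (1%:M - coarse_proj A Ph) *m S)
    & mnorm A E = 1 - lambda (ns + nc - n + 1)
        (invmx Mst *m S^T *m A *m (1%:M - coarse_proj A P) *m S)].
Proof.
move=> Mst E Eh.
have n_gt0 : (0 < n)%N by exact: leq_ltn_trans hnc.
have hnchn : (nch < n)%N by case/andP: hnch.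
split; [|exact: mnorm_two_level_prolongation..].
exact: mnorm_two_level_mono.
Qed.
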